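(* Let $\phi:\mathbb R^n\to\overline{\mathbb R}$ be a 1-coercive and Legendre dgf, $X=\operatorname{dom}\phi$, and let $f:X\to\mathbb R$ and $L>0$ be fixed. If $\overleftarrow{\partial}{}^{L\phi}f(x)\neq\emptyset$ and $\overleftarrow{\partial}{}^{L\phi}(-f)(x)\neq\emptyset$ for every $x\in\operatorname{int}X$, then $L^{-1}f$ is $\mathrm B_\phi$-smooth. The converse implication also holds provided that $$f(x)=\lim_{\operatorname{int}X\ni x'\to x}f(x')\qquad\forall x\in X\setminus\operatorname{int}X.$$
   Context: $\overline{\mathbb R}=[-\infty,\infty]$. A distance-generating function (dgf) is a proper, lsc, convex $\phi:\mathbb R^n\to\overline{\mathbb R}$ differentiable on $\operatorname{int}\operatorname{dom}\phi\neq\emptyset$. $D_\phi(x,y)=\phi(x)-\phi(y)-\langle\nabla\phi(y),x-y\rangle$ if $y\in\operatorname{int}\operatorname{dom}\phi$, and $\infty$ otherwise. $\phi$ is Legendre if it is essentially smooth (differentiable on $\operatorname{int}\operatorname{dom}\phi\ne\emptyset$ with $\|\nabla\phi(x^k)\|\to\infty$ whenever $\operatorname{int}\operatorname{dom}\phi\ni x^k\to x\in\operatorname{bdry}\operatorname{dom}\phi$) and essentially strictly convex (strictly convex on every convex subset of $\operatorname{dom}\partial\phi$). $\phi$ is 1-coercive if $\liminf_{\|x\|\to\infty}\phi(x)/\|x\|=\infty$. Left Bregman level proximal subdifferential with kernel $L\phi$ and stepsize $1$: $\bar u\in\overleftarrow{\partial}{}^{L\phi}f(\bar x)$ iff $\bar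 x\in\operatorname{int}X$ and $f(x)\ge f(\bar x)+\langle\bar u,x-\bar x\rangle-L\,D_\phi(x,\bar x)$ for all $x\in X$. A function $h:X\to\mathbb R$ is $\mathrm B_\phi$-smooth if both $h+\phi$ and $-h+\phi$ are convex on $\operatorname{int}X$. *)

(* Defs.v *)
From mathcomp Require Import all_boot all_order all_algebra.
From mathcomp Require Import all_classical all_reals all_analysis.

Set Implicit Arguments.
Unset Strict Implicit.
Unset Printing Implicit Defensive.

Import Order.TTheory GRing.Theory Num.Theory.
Import numFieldNormedType.Exports.

Local Open Scope classical_set_scope.
Local Open Scope ring_scope.

Definition dotp (R : realType) (n : nat) (u v : 'rV[R]_n) : R :=
  \sum_(i < n) u ord0 i * v ord0 i.

(* The library norm on matrices is the sup norm; this is the Euclidean one. *)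
Definition enorm (R : realType) (n : nat) (u : 'rV[R]_n) : R :=
  Num.sqrt (dotp u u).

Definition edom (R : realType) (n : nat) (phi : 'rV[R]_n -> \bar R) :
    set 'rV[R]_n :=
  [set x | (phi x < +oo)%E].

Definition proper_efun (R : realType) (n : nat) (phi : 'rV[R]_n -> \bar R) :=
  (forall x, (-oo < phi x)%E) /\ edom phi !=set0.

(* Used only together with properness, so that the right-hand side never has
   the form (-oo) + (+oo). *)
Definition convex_efun (R : realType) (n : nat) (phi : 'rV[R]_n -> \bar R) :=
  forall (x y : 'rV[R]_n) (t : R), 0 < t -> t < 1 ->
    (phi (t *: x + (1 - t) *: y)%R
      <= t%:E * phi x + (1 - t)%R%:E * phi y)%E.

Definition strictly_convex_on (R : realType) (n : nat) (C : set 'rV[R]_n)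
    (phi : 'rV[R]_n -> \bar R) :=
  forall (x y : 'rV[R]_n) (t : R), C x -> C y -> x <> y -> 0 < t -> t < 1 ->
    (phi (t *: x + (1 - t) *: y)%R
      < t%:E * phi x + (1 - t)%R%:E * phi y)%E.

(* [fine \o phi] coincides with [phi] near each point of the interior of
   [edom phi] when [phi] is proper; differentiability and gradients are only
   taken at such points. *)
Definition grad (R : realType) (n : nat) (phi : 'rV[R]_n -> \bar R)
    (y : 'rV[R]_n) : 'rV[R]_n :=
  \row_(i < n) 'd (fine \o phi) y (delta_mx ord0 i).

Definition differentiable_int_dom (R : realType) (n : nat)
    (phi : 'rV[R]_n -> \bar R) :=
  (edom phi)° !=set0 /\
  forall y, (edom phi)° y -> differentiable (fine \o phi) y.

Definition dgf (R : realType) (n : nat) (phi : 'rV[R]_n -> \bar R) :=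
  [/\ proper_efun phi, lower_semicontinuous phi, convex_efun phi
    & differentiable_int_dom phi].

Definition bregman (R : realType) (n : nat) (phi : 'rV[R]_n -> \bar R)
    (x y : 'rV[R]_n) : \bar R :=
  if `[< (edom phi)° y >] then
    (phi x - phi y - (dotp (grad phi y) (x - y)%R)%:E)%E
  else +oo%E.

Definition subdiff (R : realType) (n : nat) (phi : 'rV[R]_n -> \bar R)
    (x : 'rV[R]_n) : set 'rV[R]_n :=
  [set u | phi x \is a fin_num /\
           forall z, (phi x + (dotp u (z - x)%R)%:E <= phi z)%E].

Definition bdry (R : realType) (n : nat) (A : set 'rV[R]_n) : set 'rV[R]_n :=
  closure A `\` A°.

Definition essentially_smooth (R : realType) (n : nat)
    (phi : 'rV[R]_n -> \bar R) :=
  differentiable_int_dom phi /\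
  forall (u : nat -> 'rV[R]_n) (x : 'rV[R]_n),
    (forall k, (edom phi)° (u k)) -> bdry (edom phi) x ->
    u k @[k --> \oo] --> x -> enorm (grad phi (u k)) @[k --> \oo] --> +oo.

Definition essentially_strictly_convex (R : realType) (n : nat)
    (phi : 'rV[R]_n -> \bar R) :=
  forall C : set 'rV[R]_n, convex_set C ->
    C `<=` [set x | subdiff phi x !=set0] -> strictly_convex_on C phi.

Definition legendre (R : realType) (n : nat) (phi : 'rV[R]_n -> \bar R) :=
  essentially_smooth phi /\ essentially_strictly_convex phi.

Definition enorm_pinfty (R : realType) (n : nat) : set_system 'rV[R]_n :=
  filter_from setT (fun M : R => [set x | M < enorm x]).

Definition coercive1 (R : realType) (n : nat) (phi : 'rV[R]_n -> \bar R) :=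
  limf_einf (fun x => (phi x * ((enorm x)^-1)%:E)%E) (@enorm_pinfty R n)
    = +oo%E.

(* Functions on X = [edom phi] are represented by total functions, of which
   only the values on X are ever used. *)

(* Left level proximal subdifferential with kernel L phi and stepsize 1. *)
Definition lprox_subdiff (R : realType) (n : nat) (phi : 'rV[R]_n -> \bar R)
    (L : R) (f : 'rV[R]_n -> R) (xb : 'rV[R]_n) : set 'rV[R]_n :=
  [set ub | (edom phi)° xb /\
     forall x, edom phi x ->
       ((f xb)%:E + (dotp ub (x - xb)%R)%:E - L%:E * bregman phi x xb
          <= (f x)%:E)%E].

Definition bphi_smooth (R : realType) (n : nat) (phi : 'rV[R]_n -> \bar R)
    (h : 'rV[R]_n -> R) :=
  convex_function (edom phi)° (fun x => h x + fine (phi x)) /\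
  convex_function (edom phi)° (fun x => - h x + fine (phi x)).

(* Main.v *)
Require Import Defs.
From HB Require Import structures.
From mathcomp Require Import all_boot all_order all_algebra.
From mathcomp Require Import all_classical all_reals all_analysis.
From mathcomp Require Import ring lra.

(** Substituting the definition of the Bregman distance and dividing by [L], the
    inequality defining the left level proximal subdifferential of [f] at an
    interior point [x] becomes affine: [u] belongs to it iff
    [L^-1 u + grad phi x] is an ordinary subgradient at [x] of
    [g := L^-1 f + phi], tested against the points of [X = dom phi]
    ([lprox_subdiffP]). So the theorem compares convexity of [g], and of its
    counterpart [g' := - L^-1 f + phi] for [- f], on the interior of [X] with
    existence of subgradients there, valid on all of [X].

    If subgradients exist at every interior point, then [g] is a supremum of
    affine functions on that convex set, hence convex ([convex_of_supported]).

    Conversely, let [g] and [g'] be convex on the interior of [X]. Their sum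
    [g + g' = 2 phi] is differentiable, so their directional derivatives at [x],
    which are sublinear, add up to a linear map; hence each of them is linear.
    Since the directional derivative of a convex function always minorizes its
    increments, it is the wanted subgradient ([supported_of_derivable_add]). This gives the subgradient
    inequality at interior points only. A point [z] of [X] outside the interior
    is reached along the segment from [x], which stays in the interior before
    [z]; there [f] converges to [f z] by assumption, while [phi] stays below its
    chord, which converges to [phi z] ([supported_interior]). *)

Set Implicit Arguments.
Unset Strict Implicit.
Unset Printing Implicit Defensive.

Import Order.TTheory GRing.Theory Num.Theory.
Import numFieldNormedType.Exports.

Local Open Scope classical_set_scope.
Local Open Scope ring_scope.

(** * Convexity with scalar coefficients *)

Section convexity_in_coordinates.
Context {R : realType} {V : lmodType R}.
Implicit Types (U : set V) (g : V -> R) (x y : V) (t : R).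

Lemma convex_setP U : convex_set U <->
  forall x y t, U x -> U y -> 0 <= t -> t <= 1 -> U (t *: x + (1 - t) *: y).
Proof.
split=> [cU x y t Ux Uy t0 t1|cU x y t /set_mem Ux /set_mem Uy].
  by have := cU x y (Itv01 t0 t1) (mem_set Ux) (mem_set Uy) => /set_mem.
by apply/mem_set; apply: cU.
Qed.

Lemma convex_functionP U g : convex_function U g <->
  forall x y t, U x -> U y -> 0 <= t -> t <= 1 ->
    g (t *: x + (1 - t) *: y) <= t * g x + (1 - t) * g y.
Proof.
split=> [cg x y t Ux Uy t0 t1|cg t x y /set_mem Ux /set_mem Uy].
  exact: (cg (Itv01 t0 t1) x y (mem_set Ux) (mem_set Uy)).
by apply: cg.
Qed.

End convexity_in_coordinates.

(** * Supporting functionals *)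

Section supporting_functionals.
Context {R : realType} {V : lmodType R}.
Implicit Types (U : set V) (g : V -> R) (x y : V) (t : R).

(** Subgradients as linear functionals, so that no inner product is needed; the
    inequality is tested on [U] only. *)
Definition supported U g x :=
  exists p : {scalar V}, forall z, U z -> g x + p (z - x) <= g z.

(** The support inequality at a convex combination [w] of [x] and [y], tested at
    [x] and at [y] and averaged with the same weights, has no linear term left,
    since the weighted sum of [x - w] and [y - w] vanishes. *)
Lemma convex_of_supported U g : convex_set U ->
  (forall x, U x -> supported U g x) -> convex_function U g.
Proof.
move=> /convex_setP cU sg; apply/convex_functionP => x y t Ux Uy t0 t1.
have [p pP] := sg _ (cU x y t Ux Uy t0 t1).
set w := _ + _ in pP *.
have wx : x - w = (1 - t) *: (x - y).
  by rewrite /w opprD addrA -{1}(scale1r x) -scalerBl -scalerBr.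
have wy : y - w = - t *: (x - y).
  rewrite /w -{1}(scale1r y) opprD addrCA -scalerBl opprB addrCA subrr addr0.
  by rewrite scaleNr scalerBr opprB addrC.
have := pP _ Ux; have := pP _ Uy.
rewrite wx wy !linearZ_LR /= => /(ler_wpM2l (_ : 0 <= 1 - t)) hy.
move=> /(ler_wpM2l t0); have {}hy := hy ltac:(lra).
set a := p _ in hy *; lra.
Qed.

End supporting_functionals.

(** * Directional derivatives of a convex function *)

Section directional_derivatives.
Context {R : realType} {V : normedModType R}.
Variables (U : set V) (g : V -> R) (x : V).
Hypotheses (cU : convex_set U) (cg : convex_function U g) (Ux : nbhs x U).
Implicit Types (a b d : V) (s t : R).

Definition slope d t := t^-1 * (g (x + t *: d) - g x).

(** For convex [g] the slopes are monotone in [t], so that this infimum is their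
    limit at [0], the one-sided directional derivative. As an infimum, it
    minorizes every slope by definition. *)
Definition dirder d :=
  inf [set slope d t | t in [set t | 0 < t /\ U (x + t *: d)]].

Lemma near_ray d : \forall t \near 0, U (x + t *: d).
Proof.
have : (fun t : R => x + t *: d) @ 0 --> x.
  rewrite -[X in _ --> X]addr0 -(scale0r d).
  by apply: cvgD; [exact: cvg_cst|exact: cvgZr_tmp].
exact.
Qed.

Lemma slope0 t : slope 0 t = 0.
Proof. by rewrite /slope scaler0 addr0 subrr mulr0. Qed.

Lemma slopeZ c d t : c != 0 -> slope (c *: d) (t / c) = c * slope d t.
Proof.
by move=> c0; rewrite /slope scalerA divfK// invfM invrK mulrA (mulrC c).
Qed.

(** The harmonic choice of [r] makes [x + r (a + b)] the convex combination of
    [x + s a] and [x + t b] in which the increments in the directions [a] and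
    [b] both get the length [r]. Since [s] and [t] are arbitrary, taking infima over
    them yields the subadditivity of the directional derivative. *)
Lemma slopeD a b s t : 0 < s -> 0 < t -> U (x + s *: a) -> U (x + t *: b) ->
  let r := s * t / (s + t) in
  [/\ 0 < r, U (x + r *: (a + b)) & slope (a + b) r <= slope a s + slope b t].
Proof.
move=> s0 t0 Ua Ub r.
have st0 : 0 < s + t by exact: addr_gt0.
have r0 : 0 < r by rewrite divr_gt0 ?mulr_gt0.
pose l := t / (s + t).
have l0 : 0 <= l by rewrite divr_ge0// ltW.
have l1 : l <= 1 by rewrite ler_pdivrMr// mul1r lerDr ltW.
have ls : l * s = r by rewrite /l /r; field; rewrite gt_eqF.
have lt : (1 - l) * t = r by rewrite /l /r; field; rewrite gt_eqF.
have pE : l *: (x + s *: a) + (1 - l) *: (x + t *: b) = x + r *: (a + b).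
  rewrite 2!scalerDr !scalerA ls lt addrACA -scalerDl subrKC scale1r.
  by rewrite -scalerDr.
split=> //; first by rewrite -pE; move/convex_setP: cU; apply.
have : g (x + r *: (a + b)) <= l * g (x + s *: a) + (1 - l) * g (x + t *: b).
  by rewrite -pE; move/convex_functionP: cg; apply.
move=> gr; rewrite /slope ler_pdivrMl//.
have rs : r / s = l by rewrite -ls mulfK// gt_eqF.
have rt : r / t = 1 - l by rewrite -lt mulfK// gt_eqF.
by rewrite mulrDr !mulrA rs rt; lra.
Qed.

(** This is [slopeD] with opposite directions; it bounds the slopes from below,
    so that the infimum defining [dirder] is a genuine one. *)
Lemma slope_opp_ge0 d s t : 0 < s -> 0 < t -> U (x + s *: d) ->
  U (x + t *: - d) -> 0 <= slope d s + slope (- d) t.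
Proof.
move=> s0 t0 Us Ut; have [_ _] := slopeD s0 t0 Us Ut.
by rewrite subrr slope0.
Qed.

Lemma short_ray d : exists t, 0 < t /\ U (x + t *: d).
Proof.
have /nbhs_normP[e /= e0 eU] := near_ray d.
exists (e / 2); split; first exact: divr_gt0.
by apply: eU; rewrite /ball_/= sub0r normrN gtr0_norm ?divr_gt0//; lra.
Qed.

Lemma dirder_le d t : 0 < t -> U (x + t *: d) -> dirder d <= slope d t.
Proof.
move=> t0 Ut; apply: ge_inf; last by exists t.
have [s [s0 Us]] := short_ray (- d).
exists (- slope (- d) s) => _ [r [r0 Ur] <-].
by rewrite -subr_ge0 opprK slope_opp_ge0.
Qed.

Lemma le_dirder d c : (forall t, 0 < t -> U (x + t *: d) -> c <= slope d t) ->
  c <= dirder d.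
Proof.
move=> cd; apply: lb_le_inf; last by move=> _ [t [t0 Ut] <-]; exact: cd.
by have [t Ut] := short_ray d; exists (slope d t), t.
Qed.

Lemma dirder_minorant z : U z -> g x + dirder (z - x) <= g z.
Proof.
move=> Uz; have := @dirder_le (z - x) 1 ltr01.
by rewrite /slope invr1 mul1r scale1r subrKC => /(_ Uz); rewrite -lerBrDl.
Qed.

Lemma dirder0 : dirder 0 = 0.
Proof.
apply/eqP; rewrite eq_le; apply/andP; split.
  rewrite -(slope0 1) dirder_le// scaler0 addr0; exact: nbhs_singleton.
by apply: le_dirder => t _ _; rewrite slope0.
Qed.

Lemma dirderD a b : dirder (a + b) <= dirder a + dirder b.
Proof.
rewrite -lerBlDl; apply: le_dirder => t t0 Ut.
rewrite lerBlDl -lerBlDr; apply: le_dirder => s s0 Us; rewrite lerBlDr.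
have [r0 Ur] := slopeD s0 t0 Us Ut.
exact/le_trans/dirder_le.
Qed.

Lemma dirderZ c d : 0 < c -> dirder (c *: d) = c * dirder d.
Proof.
have dirderZ_le k u : 0 < k -> dirder (k *: u) <= k * dirder u.
  move=> k0; rewrite -ler_pdivrMl//; apply: le_dirder => t t0 Ut.
  rewrite ler_pdivrMl// -slopeZ ?gt_eqF//; apply: dirder_le.
    exact: divr_gt0.
  by rewrite scalerA divfK// gt_eqF.
move=> c0; apply/eqP; rewrite eq_le dirderZ_le//=.
rewrite -ler_pdivlMl//.
by rewrite -{1}(scalerK (lt0r_neq0 c0) d) dirderZ_le ?invr_gt0.
Qed.

(** Sublinearity gives [0 <= dirder d + dirder (- d)]; the reverse inequality
    makes [dirder] odd, and an odd sublinear map is linear. *)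
Lemma dirder_scalar : (forall d, dirder d + dirder (- d) <= 0) ->
  scalar dirder.
Proof.
move=> oppr_le.
have dirderN d : dirder (- d) = - dirder d.
  apply/eqP; rewrite -subr_eq0 opprK addrC eq_le oppr_le/=.
  by rewrite -dirder0 -(subrr d) dirderD.
have dirderDE a b : dirder (a + b) = dirder a + dirder b.
  apply/eqP; rewrite eq_le dirderD/=.
  by rewrite -lerBrDr -dirderN (le_trans _ (dirderD _ _))// addrK.
move=> c a b; rewrite dirderDE; congr (_ + _).
have [c0|c0|->] := ltgtP c 0; last by rewrite scale0r dirder0 mul0r.
  by rewrite -{1}(opprK c) scaleNr dirderN dirderZ ?oppr_gt0// mulNr opprK.
exact: dirderZ.
Qed.

End directional_derivatives.

(** * Splittings of a differentiable function into convex summands *)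

Section splitting.
Context {R : realType} {V : normedModType R}.
Variables (U : set V) (g h : V -> R) (x : V).
Hypotheses (cU : convex_set U) (Ux : nbhs x U).
Hypotheses (cg : convex_function U g) (ch : convex_function U h).

(** For small [t] the slopes of [g + h] in the directions [d] and [- d] nearly
    cancel. Those of [h] alone have a nonnegative sum, so the sum of those of [g]
    is nearly nonpositive. *)
Lemma dirder_opp_le0 d : derivable (g \+ h : V -> R^o) x d ->
  dirder U g x d + dirder U g x (- d) <= 0.
Proof.
move=> /cvg_ex[D qD]; apply/ler_addgt0Pl => e e0; rewrite addr0.
have e20 : 0 < e / 2 by exact: divr_gt0.
have /cvgrPdist_lt/(_ _ e20) := qD.
rewrite near_withinE => nq.
have : \forall t \near (0 : R),
    [/\ t != 0 -> `|D - slope (g \+ h) x d t| < e / 2,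
        U (x + t *: d) & U (x + t *: - d)].
  have := near_ray Ux d; have := near_ray Ux (- d); move: nq.
  apply: filterS3 => t nq Ut UNt; split=> // t0; have := nq t0.
  by rewrite /slope /= (addrC (t *: d)).
move=> /nbhs_normP[r /= r0 rP].
have r20 : 0 < r / 2 by exact: divr_gt0.
have [|/(_ (lt0r_neq0 r20)) q1 U1 U2] := rP (r / 2).
  by rewrite /ball_/= sub0r normrN gtr0_norm//; lra.
have [|q2 _ _] := rP (- (r / 2)).
  by rewrite /ball_/= sub0r opprK gtr0_norm//; lra.
have {}q2 := q2 (ltac:(by rewrite oppr_eq0 gt_eqF)).
have h_ge0 := slope_opp_ge0 cU ch r20 r20 U1 U2.
have := lerD (dirder_le cU cg Ux r20 U1) (dirder_le cU cg Ux r20 U2).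
move=> /le_trans; apply.
(* A slope along [d] with a negative step is minus a slope along [- d]; this is
   where the limit being two-sided matters. *)
have slopeNN : slope (g \+ h) x d (- (r / 2)) =
    - slope (g \+ h) x (- d) (r / 2).
  by rewrite /slope invrN mulNr scaleNr scalerN.
have slope_add u : slope (g \+ h) x u (r / 2) =
    slope g x u (r / 2) + slope h x u (r / 2).
  by rewrite /slope /=; ring.
move: q1 q2; rewrite slopeNN !slope_add !ltr_norml.
by move=> /andP[q1 q1'] /andP[q2 q2']; lra.
Qed.

Lemma supported_of_derivable_add :
  (forall d, derivable (g \+ h : V -> R^o) x d) -> supported U g x.
Proof.
move=> dgh.
have ps := dirder_scalar cU cg Ux (fun d => dirder_opp_le0 (dgh d)).
pose p : {scalar V} := HB.pack (dirder U g x)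
  (GRing.isLinear.Build _ _ _ _ _ ps).
by exists p => z Uz; exact: dirder_minorant.
Qed.

End splitting.

(** * From the interior of a convex set to the set *)

Section interior_of_convex_sets.
Context {R : realType} {V : normedModType R}.
Implicit Types (X : set V) (x z : V) (t : R).

(** Near [t x + (1 - t) z], the homothety of centre [z] and ratio [t^-1] lands near
    [x], hence in [X]; applying the inverse homothety, of ratio [t <= 1], keeps
    the point in [X]. *)
Lemma interior_conv X x z t : convex_set X -> X° x -> X z ->
  0 < t -> t <= 1 -> X° (t *: x + (1 - t) *: z).
Proof.
move=> /convex_setP cX Xx Xz t0 t1; rewrite /interior.
set w := _ + _.
have pullback : (fun y => t^-1 *: (y - (1 - t) *: z)) @ w --> x.
  have -> : x = t^-1 *: (w - (1 - t) *: z) by rewrite addrK scalerK// gt_eqF.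
  apply: (@cvgZl_tmp _ _ _ _ _ t^-1 (fun y => y - (1 - t) *: z)).
  by apply: cvgB; [exact: cvg_id|exact: cvg_cst].
apply: filterS (pullback _ Xx : nbhs w _) => y /= Xy.
by have := cX _ _ _ Xy Xz (ltW t0) t1; rewrite scalerKV ?gt_eqF// subrK.
Qed.

Lemma convex_set_interior X : convex_set X -> convex_set X°.
Proof.
move=> cX; apply/convex_setP => x y t Xx Xy.
rewrite le_eqVlt => /predU1P[<- _|t0 t1].
  by rewrite scale0r add0r subr0 scale1r.
by apply: interior_conv => //; exact: interior_subset.
Qed.

(** Along the segment from [x] to [z] the summand [h] is controlled by its limit
    at [z] and the summand [k] by its chord, an upper bound whose limit at [z] is
    [k z]. *)
Lemma supported_interior X (h k : V -> R) x :
  convex_set X -> convex_function X k -> X° x ->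
  (forall z, (X `\` X°) z -> h z' @[z' --> within X° (nbhs z)] --> h z) ->
  supported X° (h \+ k) x -> supported X (h \+ k) x.
Proof.
move=> cX /convex_functionP ck Xx hlim [p pP]; exists p => z Xz.
have [/pP//|nXz] := pselect (X° z).
pose y t := t *: x + (1 - t) *: z.
have y_cvg : y t @[t --> (0 : R)^'+] --> z.
  apply: cvg_at_right_filter.
  have -> : z = y 0 by rewrite /y scale0r add0r subr0 scale1r.
  apply: cvgD; apply: cvgZr_tmp; first exact: cvg_id.
  by apply: cvgB; [exact: cvg_cst|exact: cvg_id].
have y_interior : \forall t \near (0 : R)^'+, X° (y t).
  near=> t; have t0 : 0 < t by near: t; exact: nbhs_right_gt.
  have t1 : t <= 1 by near: t; exact: nbhs_right_le.
  exact: interior_conv.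
have y_within : y t @[t --> (0 : R)^'+] --> within X° (nbhs z).
  move=> A zA.
  by apply: filterS2 (y_cvg _ zA) y_interior => t; apply.
have hy_cvg : h (y t) @[t --> (0 : R)^'+] --> h z.
  exact: cvg_comp y_within (hlim _ (conj Xz nXz)).
(* [c t] is the lower bound for [h (y t)] left by the support inequality at
   [y t] once [k (y t)] is replaced by its chord. *)
pose c t := (h \+ k) x + (1 - t) * p (z - x) - (t * k x + (1 - t) * k z).
have c_cvg : c t @[t --> (0 : R)^'+] --> c 0.
  apply: cvg_at_right_filter.
  have s_cvg : 1 - t @[t --> (0 : R)] --> (1 - 0 : R).
    by apply: cvgB; [exact: cvg_cst|exact: cvg_id].
  apply: cvgB; apply: cvgD; first exact: cvg_cst.
  - by apply: cvgM => //; exact: cvg_cst.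
  - by apply: cvgM; [exact: cvg_id|exact: cvg_cst].
  - by apply: cvgM => //; exact: cvg_cst.
have : c 0 <= h z.
  apply: ler_cvg_to c_cvg hy_cvg _; near=> t.
  have t0 : 0 < t by near: t; exact: nbhs_right_gt.
  have t1 : t <= 1 by near: t; exact: nbhs_right_le.
  have := pP _ (interior_conv cX Xx Xz t0 t1).
  have -> : t *: x + (1 - t) *: z - x = (1 - t) *: (z - x).
    by rewrite scalerBr (scalerBl 1 t x) scale1r opprB addrCA addrA.
  rewrite linearZ_LR /=.
  have := ck _ _ _ (interior_subset Xx) Xz (ltW t0) t1.
  rewrite -/(y t) /c /=; set q := p _; lra.
by rewrite /c /=; set q := p _; lra.
Unshelve. all: by end_near. Qed.

End interior_of_convex_sets.

(** * Linear functionals on row vectors *)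

Section dot_product.
Context {R : realType} {n : nat}.
Implicit Types u v d : 'rV[R]_n.

Lemma dotp_scalar u : scalar (dotp u).
Proof.
move=> a v w; rewrite /dotp mulr_sumr -big_split/=; apply: eq_bigr => i _.
by rewrite !mxE; ring.
Qed.

Lemma dotpDl u v d : dotp (u + v) d = dotp u d + dotp v d.
Proof.
by rewrite /dotp -big_split/=; apply: eq_bigr => i _; rewrite mxE mulrDl.
Qed.

Lemma dotpZl a u d : dotp (a *: u) d = a * dotp u d.
Proof.
by rewrite /dotp mulr_sumr; apply: eq_bigr => i _; rewrite mxE mulrA.
Qed.

Lemma scalar_dotp (p : {scalar 'rV[R]_n}) : exists v, p =1 dotp v.
Proof.
exists (\row_i p (delta_mx ord0 i)) => d.
rewrite {1}(row_sum_delta d) linear_sum; apply: eq_bigr => i _ /=.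
by rewrite linearZ_LR mxE mulrC.
Qed.

End dot_product.

(** * The left level proximal subdifferential *)

Section level_proximal_subdifferential.
Context {R : realType} {n : nat}.
Variables (phi : 'rV[R]_n -> \bar R).
Hypothesis phi_proper : proper_efun phi.
Implicit Types (f : 'rV[R]_n -> R) (x y z u : 'rV[R]_n).

Lemma edom_fineK x : edom phi x -> (fine (phi x))%:E = phi x.
Proof.
move=> dx; rewrite fineK// fin_real//; apply/andP; split => //.
by case: phi_proper => + _; apply.
Qed.

Lemma convex_edom : convex_efun phi ->
  convex_set (edom phi) /\ convex_function (edom phi) (fine \o phi).
Proof.
move=> cphi.
have conv x y t : edom phi x -> edom phi y -> 0 <= t -> t <= 1 ->
    (phi (t *: x + (1 - t) *: y)
      <= (t * fine (phi x) + (1 - t) * fine (phi y))%:E)%E.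
  move=> dx dy; rewrite le_eqVlt => /predU1P[<- _|t0].
    by rewrite scale0r add0r subr0 scale1r mul0r mul1r add0r edom_fineK.
  rewrite le_eqVlt => /predU1P[->|t1].
    by rewrite subrr scale0r addr0 scale1r mul0r mul1r addr0 edom_fineK.
  by rewrite EFinD !EFinM !edom_fineK//; exact: cphi.
have cdom : forall x y t, edom phi x -> edom phi y -> 0 <= t -> t <= 1 ->
    edom phi (t *: x + (1 - t) *: y).
  by move=> x y t dx dy t0 t1; apply: le_lt_trans (ltry _); exact: conv.
split; first exact/convex_setP.
apply/convex_functionP => x y t dx dy t0 t1 /=.
by rewrite -lee_fin edom_fineK ?conv//; exact: cdom.
Qed.

(** The terms of the Bregman distance that depend on [z] are [phi z] and a linear
    one; the former moves to the right-hand side and the latter merges with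
    [u], which turns the inequality into a plain subgradient inequality. *)
Lemma lprox_subdiffP (L : R) f x u : 0 < L -> (edom phi)° x ->
  lprox_subdiff phi L f x u <-> forall z, edom phi z ->
    L^-1 * f x + fine (phi x) + dotp (L^-1 *: u + grad phi x) (z - x)
      <= L^-1 * f z + fine (phi z).
Proof.
move=> L0 ix.
have ineq z : edom phi z ->
    ((f x)%:E + (dotp u (z - x))%:E - L%:E * bregman phi z x <= (f z)%:E)%E =
    (L^-1 * f x + fine (phi x) + dotp (L^-1 *: u + grad phi x) (z - x)
      <= L^-1 * f z + fine (phi z)).
  move=> dz; have -> : bregman phi z x =
      (fine (phi z) - fine (phi x) - dotp (grad phi x) (z - x))%:E.
    rewrite /bregman asboolT// !EFinB !edom_fineK//; exact: interior_subset ix.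
  rewrite lee_fin dotpDl dotpZl -[RHS](ler_pM2l L0).
  set a := fine _; set b := fine _; set c := dotp _ _; set d := dotp _ _.
  rewrite !mulrDr !(mulVKf (lt0r_neq0 L0)).
  by apply/idP/idP; lra.
split=> [[_ sub] z dz|sub]; first by rewrite -ineq//; exact: sub.
by split=> // z dz; rewrite ineq//; exact: sub.
Qed.

Lemma lprox_supported (L : R) f x : 0 < L -> (edom phi)° x ->
  lprox_subdiff phi L f x !=set0 <->
  supported (edom phi) (fun z => L^-1 * f z + fine (phi z)) x.
Proof.
move=> L0 ix; split=> [[u /lprox_subdiffP sub]|[p pP]].
  pose p : {scalar 'rV[R]_n} := HB.pack (dotp (L^-1 *: u + grad phi x))
    (GRing.isLinear.Build _ _ _ _ _ (dotp_scalar (L^-1 *: u + grad phi x))).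
  by exists p => z dz; exact: sub.
have [v pv] := scalar_dotp p.
exists (L *: (v - grad phi x)); apply/lprox_subdiffP => // z dz.
by rewrite scalerK ?gt_eqF// subrK -pv; exact: pP.
Qed.

End level_proximal_subdifferential.

(** * Smoothness relative to the kernel *)

Theorem theorem4p16 (R : realType) (n : nat) (phi : 'rV[R]_n -> \bar R)
    (f : 'rV[R]_n -> R) (L : R)
    (phi_dgf : dgf phi) (phi_coercive : coercive1 phi)
    (phi_legendre : legendre phi) (L_gt0 : 0 < L) :
  ((forall x, (edom phi)° x ->
      lprox_subdiff phi L f x !=set0 /\
      lprox_subdiff phi L (fun z => - f z) x !=set0) ->
    bphi_smooth phi (fun x => L^-1 * f x)) /\
  ((forall x, (edom phi `\` (edom phi)°) x ->
      f x' @[x' --> within (edom phi)° (nbhs x)] --> f x) ->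
    bphi_smooth phi (fun x => L^-1 * f x) ->
    forall x, (edom phi)° x ->
      lprox_subdiff phi L f x !=set0 /\
      lprox_subdiff phi L (fun z => - f z) x !=set0).
Proof.
have [pr _ cphi [_ dphi]] := phi_dgf.
have [cX ck] := convex_edom pr cphi.
have cI := convex_set_interior cX.
have NE : (fun x => L^-1 * - f x + fine (phi x)) =
    (fun x => - (L^-1 * f x) + fine (phi x)).
  by apply/funext => x; rewrite mulrN.
split=> [sub|flim [cp cm] x ix].
  have convex_of_lprox h :
      (forall x, (edom phi)° x -> lprox_subdiff phi L h x !=set0) ->
      convex_function (edom phi)° (fun x => L^-1 * h x + fine (phi x)).
    move=> hsub; apply: convex_of_supported => // x ix.
    have /(lprox_supported pr _ L_gt0 ix)[p pP] := hsub x ix.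
    by exists p => z /interior_subset; exact: pP.
  split; first by apply: convex_of_lprox => x /sub[].
  by rewrite -NE; apply: convex_of_lprox => x /sub[].
rewrite -NE in cm.
have lprox_of_convex h :
    convex_function (edom phi)° (fun x => L^-1 * h x + fine (phi x)) ->
    convex_function (edom phi)° (fun x => L^-1 * - h x + fine (phi x)) ->
    (forall x, (edom phi `\` (edom phi)°) x ->
      h x' @[x' --> within (edom phi)° (nbhs x)] --> h x) ->
    lprox_subdiff phi L h x !=set0.
  move=> chp chm hlim; apply/lprox_supported => //.
  apply: (supported_interior (h := fun z => L^-1 * h z) cX ck ix).
    by move=> z Xz; apply: cvgM; [exact: cvg_cst|exact: hlim].
  apply: (supported_of_derivable_add cI _ chp chm).
    by apply: nbhs_interior.
  move=> d.
  (* The multiples of [h] cancel, leaving twice [phi]. *)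
  rewrite (_ : _ \+ _ = (fine \o phi) + (fine \o phi)).
    by apply: derivableD; apply: diff_derivable; exact: dphi.
  by apply/funext => z; rewrite /= mulrN addrACA subrr add0r.
split; first exact: lprox_of_convex.
apply: lprox_of_convex => //.
  by rewrite (_ : (fun x => _) = (fun x => L^-1 * f x + fine (phi x)))//;
     apply/funext => z; rewrite opprK.
by move=> z Xz; apply: cvgN; exact: flim.
Qed.
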